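(* Let $Q$ be a medial quandle being the sum of an indecomposable affine mesh $(A_i;\varphi_{i,j};c_{i,j})$ over a set $I$, and let $\pi$ be the orbit congruence of $Q$. (1) Let $\varrho\subseteq\pi$ be a congruence relation on $Q$. Then, for each $i\in I$, the restriction of $\varrho$ to the orbit $A_i$ provides a $\mathbb{Z}[t,t^{-1}]$-submodule $M_i$ of the module $A_i$ (that is, there is a submodule $M_i$ such that for $a,b\in A_i$: $a\mathrel{\varrho}b$ if and only if $a-b\in M_i$). Moreover, $\varphi_{k,j}(M_k)\subseteq M_j$ for each $k,j\in I$. (2) Conversely, let $(M_i)_{i\in I}$ be a family such that each $M_i$ is a $\mathbb{Z}[t,t^{-1}]$-submodule of the module $A_i$ and $\varphi_{k,j}(M_k)\subseteq M_j$ for each $k,j\in I$. Then the binary relation $\varrho\subseteq\pi$ defined for $a,b\in Q$ by $$a\mathrel{\varrho}b\iff \text{there is } i\in I \text{ with } a,b\in A_i \text{ and } a-b\in M_i$$ is a congruence relation on $Q$.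
   Context: A quandle is an algebra $(Q,\ast,\backslash)$ with $x\ast x=x$; $x\ast(y\ast z)=(x\ast y)\ast(x\ast z)$; $x\backslash(x\ast y)=y=x\ast(x\backslash y)$. It is medial if $(x\ast y)\ast(u\ast v)=(x\ast u)\ast(y\ast v)$, $(x\backslash y)\backslash(u\backslash v)=(x\backslash u)\backslash(y\backslash v)$, $(x\backslash y)\ast(u\backslash v)=(x\ast u)\backslash(y\ast v)$. Let $L_a\colon x\mapsto a\ast x$. The orbits of $Q$ are the orbits of the permutation group generated by all $L_a$; the relation $\pi$ of lying in the same orbit is a congruence of $Q$. An affine mesh over a non-empty set $I$ is a triple $(A_i;\varphi_{i,j};c_{i,j})$ with $A_i$ ($i\in I$) abelian groups, $\varphi_{i,j}\colon A_i\to A_j$ homomorphisms and $c_{i,j}\in A_j$ constants ($i,j\in I$) such that for all $i,j,j',k\in I$: $1-\varphi_{i,i}$ is an automorphism of $A_i$; $c_{i,i}=0$; $\varphi_{j,k}\varphi_{i,j}=\varphi_{j',k}\varphi_{i,j'}$; $\varphi_{j,k}(c_{i,j})=\varphi_{k,k}(c_{i,k}-c_{j,k})$. It is indecomposable if each $A_j$ is generated as a group by all elements $c_{i,j}$ and $\varphi_{i,j}(a)$, $i\in I$, $a\in A_i$. The sum of the mesh is the disjoint union of the $A_i$ with $a\ast b=c_{i,j}+\varphi_{i,j}(a)+(1-\varphi_{j,j})(b)$ and $a\backslash b=(1-\varphi_{j,j})^{-1}(b-\varphi_{i,j}(a)-c_{i,j})$ for $a\in A_i$, $b\in A_j$; it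 is a medial quandle, and when the mesh is indecomposable its orbits are exactly the sets $A_i$. Each $A_i$ is regarded as a $\mathbb{Z}[t,t^{-1}]$-module via $t^n\cdot a=(1-\varphi_{i,i})^n(a)$, $n\in\mathbb{Z}$. *)

(* Defs.v *)
From HB Require Import structures.
From mathcomp Require Import all_boot all_order all_algebra.
From mathcomp Require Import boolp.

Set Implicit Arguments.
Unset Strict Implicit.
Unset Printing Implicit Defensive.

Import GRing.Theory.
Local Open Scope ring_scope.

Record quandle := Quandle {
  quandle_sort :> Type;
  qop : quandle_sort -> quandle_sort -> quandle_sort;
  qdiv : quandle_sort -> quandle_sort -> quandle_sort;
  qopxx : forall x, qop x x = x;
  qopD : forall x y z, qop x (qop y z) = qop (qop x y) (qop x z);
  qopK : forall x y, qdiv x (qop x y) = y;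
  qdivK : forall x y, qop x (qdiv x y) = y
}.

Definition medial (Q : quandle) : Prop :=
  [/\ forall x y u v : Q,
        qop (qop x y) (qop u v) = qop (qop x u) (qop y v),
      forall x y u v : Q,
        qdiv (qdiv x y) (qdiv u v) = qdiv (qdiv x u) (qdiv y v)
    & forall x y u v : Q,
        qop (qdiv x y) (qdiv u v) = qdiv (qop x u) (qop y v)].

(* The permutation group generated by all left translations. *)
Inductive left_mult_group (Q : quandle) : (Q -> Q) -> Prop :=
| LMG_translation (a : Q) : left_mult_group (qop a)
| LMG_id : left_mult_group id
| LMG_comp (g h : Q -> Q) :
    left_mult_group g -> left_mult_group h -> left_mult_group (g \o h)
| LMG_inv (g h : Q -> Q) :
    left_mult_group g -> cancel g h -> cancel h g -> left_mult_group h.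

Definition orbit_rel (Q : quandle) (x y : Q) : Prop :=
  exists2 g : Q -> Q, left_mult_group g & y = g x.

Definition congruence (Q : quandle) (R : Q -> Q -> Prop) : Prop :=
  [/\ forall x, R x x,
      forall x y, R x y -> R y x,
      forall x y z, R x y -> R y z -> R x z,
      forall x x' y y', R x x' -> R y y' -> R (qop x y) (qop x' y')
    & forall x x' y y', R x x' -> R y y' -> R (qdiv x y) (qdiv x' y')].

Definition subrel_prop (T : Type) (R S : T -> T -> Prop) : Prop :=
  forall x y, R x y -> S x y.

(* Z[t, t^-1], as the subring of the field of fractions of Z[t] whose         *)
(* elements become polynomials after multiplication by some power of t.       *)
Definition laurent_pred : pred {fraction {poly int}} :=
  fun x => `[< exists np : nat * {poly int},
                 x * (tofrac 'X) ^+ np.1 == tofrac np.2 >].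

Lemma laurent_subring_closed : subring_closed laurent_pred.
Proof.
split.
- by apply/asboolP; exists (0%N, 1); rewrite /= expr0 mulr1 rmorph1.
- move=> x y /asboolP[[n p] /= /eqP hx] /asboolP[[m q] /= /eqP hy].
  apply/asboolP; exists ((n + m)%N, p * 'X^m - q * 'X^n); apply/eqP => /=.
  rewrite rmorphB !rmorphM !rmorphXn /= -hx -hy mulrBl exprD !mulrA.
  by congr (_ - _); rewrite mulrAC.
- move=> x y /asboolP[[n p] /= /eqP hx] /asboolP[[m q] /= /eqP hy].
  apply/asboolP; exists ((n + m)%N, p * q); apply/eqP => /=.
  by rewrite rmorphM /= -hx -hy exprD mulrACA.
Qed.

HB.instance Definition _ :=
  GRing.isSubringClosed.Build _ laurent_pred laurent_subring_closed.

Record laurent := Laurent {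
  laurent_val : {fraction {poly int}};
  laurentP : laurent_val \in laurent_pred
}.

HB.instance Definition _ := [isSub for laurent_val].
HB.instance Definition _ := [Choice of laurent by <:].
HB.instance Definition _ := [SubChoice_isSubComNzRing of laurent by <:].

Lemma laurent_val1 : laurent_val 1 = 1. Proof. by []. Qed.
Lemma laurent_valD r s : laurent_val (r + s) = laurent_val r + laurent_val s.
Proof. by []. Qed.
Lemma laurent_valM r s : laurent_val (r * s) = laurent_val r * laurent_val s.
Proof. by []. Qed.

Lemma tX_neq0 : tofrac ('X : {poly int}) != 0.
Proof. by rewrite tofrac_eq0 polyX_eq0. Qed.

Lemma laurent_texp_subproof (n : int) : (tofrac 'X) ^ n \in laurent_pred.
Proof.
case: n => n; apply/asboolP.
  by exists (0%N, 'X^n); rewrite /= expr0 mulr1 rmorphXn.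
exists (n.+1, 1); rewrite /= mulVf ?rmorph1 //.
by rewrite expf_neq0 // tX_neq0.
Qed.

(* t^n *)
Definition laurent_texp (n : int) : laurent := Laurent (laurent_texp_subproof n).

Lemma laurent_repr_subproof (r : laurent) :
  exists np : nat * {poly int},
    laurent_val r * (tofrac 'X) ^+ np.1 == tofrac np.2.
Proof. exact: (asboolP _ (laurentP r)). Qed.

(* A pair (n, p) such that r = t^-n * p(t). *)
Definition laurent_repr (r : laurent) : nat * {poly int} :=
  xchoose (laurent_repr_subproof r).

Lemma laurent_reprP (r : laurent) :
  laurent_val r * (tofrac 'X) ^+ (laurent_repr r).1 = tofrac (laurent_repr r).2.
Proof. exact/eqP/(xchooseP (laurent_repr_subproof r)). Qed.

Section Inverse.
Variables (A B : choiceType) (f : A -> B) (fbij : bijective f).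

Lemma bij_surj_subproof (b : B) : exists a, f a == b.
Proof. by case: fbij => g _ gK; exists (g b); rewrite gK. Qed.

Definition bij_inv (b : B) : A := xchoose (bij_surj_subproof b).

Lemma bij_invK : cancel bij_inv f.
Proof. by move=> b; apply/eqP/(xchooseP (bij_surj_subproof b)). Qed.

Lemma bijK_inv : cancel f bij_inv.
Proof. by move=> a; apply: (bij_inj fbij); rewrite bij_invK. Qed.
End Inverse.

(* The Z[t, t^-1]-module on an abelian group A where t acts as the            *)
(* automorphism f; the module axioms and scale_texp determine the action.     *)
Definition autmodule (A : zmodType) (f : {additive A -> A})
  (fbij : bijective f) : Type := A.

HB.instance Definition _ (A : zmodType) (f : {additive A -> A})
  (fbij : bijective f) := GRing.Zmodule.on (autmodule fbij).

Section AutModule.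
Variables (A : zmodType) (f : {additive A -> A}) (fbij : bijective f).

(* f^n for n in Z *)
Definition aut_iter (n : int) : A -> A :=
  match n with
  | Posz m => iter m f
  | Negz m => iter m.+1 (bij_inv fbij)
  end.

Definition poly_act (p : {poly int}) (a : A) : A :=
  \sum_(i < size p) (iter i f a) *~ p`_i.

Definition laurent_act (r : laurent) (a : A) : A :=
  iter (laurent_repr r).1 (bij_inv fbij) (poly_act (laurent_repr r).2 a).

Lemma iter_additive n : zmod_morphism (iter n f).
Proof. by move=> a b; elim: n => //= n ->; rewrite raddfB. Qed.

HB.instance Definition _ n :=
  GRing.isZmodMorphism.Build A A (iter n f) (iter_additive n).

Lemma iter_inj n : injective (iter n f).
Proof. by elim: n => //= n IH a b /(bij_inj fbij)/IH. Qed.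

Lemma iter_invK n : cancel (iter n (bij_inv fbij)) (iter n f).
Proof. by elim: n => // n IH a; rewrite iterSr [iter n.+1 _ a]iterS bij_invK IH. Qed.

Lemma poly_actE n (p : {poly int}) a : (size p <= n)%N ->
  poly_act p a = \sum_(i < n) (iter i f a) *~ p`_i.
Proof.
move=> sz; rewrite /poly_act (big_ord_widen n (fun i => iter i f a *~ p`_i)) //.
rewrite big_mkcond; apply: eq_bigr => i _; case: ltnP => // h.
by rewrite nth_default.
Qed.

Lemma poly_actD (p q : {poly int}) a : poly_act (p + q) a = poly_act p a + poly_act q a.
Proof.
set n := maxn (size p) (size q).
rewrite !(@poly_actE n) ?leq_maxl ?leq_maxr ?size_polyD // -big_split.
by apply: eq_bigr => i _; rewrite coefD mulrzDr.
Qed.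

Lemma poly_actDr p a b : poly_act p (a + b) = poly_act p a + poly_act p b.
Proof. by rewrite -big_split; apply: eq_bigr => i _; rewrite raddfD mulrzDl. Qed.

Lemma poly_actC c a : poly_act c%:P a = a *~ c.
Proof. by rewrite (@poly_actE 1) ?size_polyC_leq1 // big_ord1 coefC. Qed.

Lemma poly_act0 a : poly_act 0 a = 0.
Proof. by rewrite -[0]/(0%:P) poly_actC mulr0z. Qed.

Lemma poly_actMX (p : {poly int}) a : poly_act (p * 'X) a = f (poly_act p a).
Proof.
rewrite (@poly_actE (size p).+1); last first.
  by rewrite (leq_trans (size_polyMleq _ _)) // size_polyX addn2.
rewrite big_ord_recl coefMX /= mulr0z add0r raddf_sum.
by apply: eq_bigr => i _; rewrite coefMX /= raddfMz.
Qed.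

Lemma poly_actMXn n (p : {poly int}) a : poly_act (p * 'X^n) a = iter n f (poly_act p a).
Proof.
by elim: n => [|n IH]; rewrite ?mulr1 // exprSr mulrA poly_actMX IH.
Qed.

Lemma poly_act_iter n p a : poly_act p (iter n f a) = iter n f (poly_act p a).
Proof.
rewrite [in RHS]/poly_act raddf_sum; apply: eq_bigr => i _.
by rewrite raddfMz /= -!iterD addnC.
Qed.

Lemma poly_actZ c (p : {poly int}) a : poly_act (c%:P * p) a = poly_act p a *~ c.
Proof.
elim/poly_ind: p => [|p d IH]; first by rewrite mulr0 poly_act0 mul0rz.
rewrite mulrDr mulrA -polyCM !poly_actD !poly_actMX IH !poly_actC.
by rewrite mulrzDl raddfMz -mulrzA [d * c]mulrC.
Qed.

Lemma poly_actM (p q : {poly int}) a : poly_act (p * q) a = poly_act p (poly_act q a).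
Proof.
elim/poly_ind: p => [|p d IH]; first by rewrite mul0r !poly_act0.
rewrite mulrDl mulrAC !poly_actD !poly_actMX IH.
by rewrite poly_actZ poly_actC.
Qed.

Lemma laurent_actP (r : laurent) n p a b :
    laurent_val r * (tofrac 'X) ^+ n = tofrac p ->
  iter n f b = poly_act p a -> laurent_act r a = b.
Proof.
move=> hr hb; have h0 := laurent_reprP r; rewrite /laurent_act.
case: (laurent_repr r) h0 => m q /= h0.
apply: (@iter_inj (n + m)); rewrite iterD iter_invK addnC iterD hb.
rewrite -!poly_actMXn; congr (poly_act _ a).
apply/eqP; rewrite -tofrac_eq; apply/eqP; rewrite !rmorphM !rmorphXn /= -hr -h0.
by rewrite mulrAC.
Qed.

Lemma laurent_act_repr (r : laurent) a :
  iter (laurent_repr r).1 f (laurent_act r a) = poly_act (laurent_repr r).2 a.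
Proof. exact: iter_invK. Qed.

Lemma laurent_actA (r s : laurent) a :
  laurent_act r (laurent_act s a) = laurent_act (r * s) a.
Proof.
have hr := laurent_reprP r; have hs := laurent_reprP s.
have er := laurent_act_repr r (laurent_act s a); have es := laurent_act_repr s a.
move: (laurent_act r _) er => b.
case: (laurent_repr r) hr => n p /= hr er.
case: (laurent_repr s) hs es => m q /= hs es.
apply/esym; apply: (@laurent_actP _ (n + m) (p * q)).
  by rewrite laurent_valM tofracM -hr -hs exprD mulrACA.
by rewrite poly_actM -es poly_act_iter addnC iterD er.
Qed.

Lemma laurent_act1 : left_id 1 laurent_act.
Proof.
move=> a; apply: (@laurent_actP _ 0%N 1).
  by rewrite laurent_val1 expr0 mulr1 tofrac1.
by rewrite -[1]/(1%:P) poly_actC.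
Qed.

Lemma laurent_actDr : right_distributive laurent_act +%R.
Proof.
move=> r a b; apply: (@laurent_actP _ (laurent_repr r).1 (laurent_repr r).2).
  exact: laurent_reprP.
by rewrite raddfD /= !laurent_act_repr poly_actDr.
Qed.

Lemma laurent_actDl a : {morph laurent_act^~ a : r s / r + s}.
Proof.
move=> r s; have hr := laurent_reprP r; have hs := laurent_reprP s.
have er := laurent_act_repr r a; have es := laurent_act_repr s a.
case: (laurent_repr r) hr er => n p /= hr er.
case: (laurent_repr s) hs es => m q /= hs es.
apply: (@laurent_actP _ (n + m) (p * 'X^m + q * 'X^n)).
  rewrite laurent_valD tofracD !tofracM !tofracXn -hr -hs mulrDl exprD !mulrA.
  by congr (_ + _); rewrite mulrAC.
by rewrite raddfD poly_actD !poly_actMXn -er -es -!iterD addnC.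
Qed.

HB.instance Definition _ :=
  @GRing.Zmodule_isLmodule.Build laurent (autmodule fbij)
    laurent_act laurent_actA laurent_act1 laurent_actDr laurent_actDl.

Lemma scale_texp (n : int) (a : autmodule fbij) :
  laurent_texp n *: a = aut_iter n a.
Proof.
case: n => n.
  apply: (@laurent_actP _ 0%N 'X^n).
    by rewrite /= expr0 mulr1 rmorphXn.
  by rewrite -['X^n]mul1r poly_actMXn -[1]/(1%:P) poly_actC.
apply: (@laurent_actP _ n.+1 1).
  rewrite /= mulVf ?rmorph1 //.
  by rewrite expf_neq0 // tX_neq0.
by rewrite /aut_iter iter_invK -[1]/(1%:P) poly_actC.
Qed.

End AutModule.

Record affine_mesh (I : Type) := AffineMesh {
  mesh_nonempty : inhabited I;
  mesh_group : I -> zmodType;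
  mesh_phi : forall i j, {additive mesh_group i -> mesh_group j};
  mesh_c : forall i j : I, mesh_group j;
  mesh_bij : forall i,
    bijective (fun a : mesh_group i => a - mesh_phi i i a);
  mesh_cii : forall i, mesh_c i i = 0;
  mesh_phi_comp : forall (i j j' k : I) (a : mesh_group i),
    mesh_phi j k (mesh_phi i j a) = mesh_phi j' k (mesh_phi i j' a);
  mesh_phi_c : forall i j k : I,
    mesh_phi j k (mesh_c i j) = mesh_phi k k (mesh_c i k - mesh_c j k)
}.

Definition group_generated (A : zmodType) (S : A -> Prop) : Prop :=
  forall H : {pred A}, zmod_closed H -> (forall x, S x -> x \in H) ->
  forall x, x \in H.

Section Mesh.
Variables (I : Type) (M : affine_mesh I).
Local Notation A := (mesh_group M).
Local Notation phi := (mesh_phi M).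
Local Notation c := (mesh_c M).

Definition indecomposable : Prop :=
  forall j, group_generated
    (fun x : A j => (exists i, x = c i j) \/ (exists i (a : A i), x = phi i j a)).

Definition one_sub_phi (i : I) (a : A i) : A i := a - phi i i a.

Lemma one_sub_phi_additive i : zmod_morphism (@one_sub_phi i).
Proof.
by move=> a b; rewrite /one_sub_phi raddfB !opprD addrACA.
Qed.

HB.instance Definition _ i :=
  GRing.isZmodMorphism.Build (A i) (A i) (@one_sub_phi i)
    (@one_sub_phi_additive i).

Lemma one_sub_phiD i : {morph @one_sub_phi i : a b / a + b}.
Proof. exact: raddfD. Qed.

Lemma one_sub_phi_bij i : bijective (@one_sub_phi i).
Proof. exact: mesh_bij. Qed.

(* A_i with the action t^n a = (1 - phi_{i,i})^n a *)
Definition mesh_module (i : I) : lmodType laurent :=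
  autmodule (one_sub_phi_bij i).

Definition mesh_carrier : Type := {i : I & A i}.

Definition mesh_op (x y : mesh_carrier) : mesh_carrier :=
  let: existT i a := x in let: existT j b := y in
  existT _ j (c i j + phi i j a + one_sub_phi b).

Definition mesh_div (x y : mesh_carrier) : mesh_carrier :=
  let: existT i a := x in let: existT j b := y in
  existT _ j (bij_inv (one_sub_phi_bij j) (b - phi i j a - c i j)).

Lemma mesh_opxx x : mesh_op x x = x.
Proof.
case: x => i a /=; congr existT.
by rewrite mesh_cii add0r /one_sub_phi addrC subrK.
Qed.

Lemma mesh_opK x y : mesh_div x (mesh_op x y) = y.
Proof.
case: x y => i a [j b] /=; congr existT.
by rewrite -addrA -opprD [phi i j a + _]addrC [X in X - _]addrC addrK bijK_inv.
Qed.

Lemma mesh_divK x y : mesh_op x (mesh_div x y) = y.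
Proof.
case: x y => i a [j b] /=; congr existT.
by rewrite bij_invK addrC addrA !subrK.
Qed.

Lemma mesh_op_subproof i j l (x : A i) (y : A j) :
  c j l + phi j l (c i j + phi i j x + one_sub_phi y) =
  one_sub_phi (c j l) + phi l l (c i l) + phi l l (phi i l x)
    + one_sub_phi (phi j l y).
Proof.
rewrite /one_sub_phi !raddfD !raddfN /= mesh_phi_c raddfB /=.
rewrite (@mesh_phi_comp _ M i j l l) (@mesh_phi_comp _ M j j l l) !addrA.
by rewrite [c j l + _ - _]addrAC.
Qed.

Lemma mesh_op_medial x y u v :
  mesh_op (mesh_op x y) (mesh_op u v) = mesh_op (mesh_op x u) (mesh_op y v).
Proof.
case: x y u v => i x [j y] [k u] [l v] /=; congr existT.
rewrite !mesh_op_subproof; move: (one_sub_phi v) => w; rewrite !one_sub_phiD.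
move: (one_sub_phi (c j l)) (one_sub_phi (c k l)) (one_sub_phi w)
  (one_sub_phi (phi j l y)) (one_sub_phi (phi k l u)) => sj sk sw sy su.
rewrite !addrA.
by rewrite [LHS](ACl (5*2*3*6*1*4*7)).
Qed.

Lemma mesh_opD x y z :
  mesh_op x (mesh_op y z) = mesh_op (mesh_op x y) (mesh_op x z).
Proof. by rewrite -{1}(mesh_opxx x) mesh_op_medial. Qed.

Definition mesh_sum : quandle :=
  Quandle mesh_opxx mesh_opD mesh_opK mesh_divK.

Lemma mesh_sum_medial : medial mesh_sum.
Proof.
have med (x y u v : mesh_sum) :
    qop (qop x y) (qop u v) = qop (qop x u) (qop y v).
  exact: mesh_op_medial.
have K (x y z : mesh_sum) : qop x y = z -> y = qdiv x z.
  by move=> <-; rewrite qopK.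
have h3 (x y u v : mesh_sum) :
    qop (qdiv x y) (qdiv u v) = qdiv (qop x u) (qop y v).
  by apply: K; rewrite med !qdivK.
split=> // x y u v.
by apply/esym/K; rewrite h3 !qdivK.
Qed.

Definition mesh_elt (i : I) (a : mesh_module i) : mesh_sum := existT _ i a.

Definition family_rel (N : forall i, {pred mesh_module i}) (x y : mesh_sum) :
    Prop :=
  exists i (a b : mesh_module i),
    [/\ x = mesh_elt a, y = mesh_elt b & a - b \in N i].

End Mesh.

(* Main.v *)
(** For [x] in [A_i], the composite of [L_x] with the inverse of [L_0], where
    [0] is the zero of [A_j], acts on [A_j] as the translation by
    [c_{i,j} + phi_{i,j}(x)]. In an indecomposable mesh these elements generate
    [A_j], so every translation of [A_j] is induced by the group generated by
    the left translations of the sum. Hence that group is transitive on [A_j],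
    and the restriction of a congruence to [A_j] is invariant under
    translations, so it is determined by the class of [0]. *)
Require Import Defs.
From HB Require Import structures.
From mathcomp Require Import all_boot all_order all_algebra.
From mathcomp Require Import boolp.

Set Implicit Arguments.
Unset Strict Implicit.
Unset Printing Implicit Defensive.

Import GRing.Theory.
Local Open Scope ring_scope.

(** [I] need not have decidable equality: proof irrelevance turns the equation between the indices
    into [erefl], so the transport is trivial. *)
Lemma existT_inj (I : Type) (T : I -> Type) i (a b : T i) :
  existT T i a = existT T i b -> a = b.
Proof.
by move=> e; have := projT2_eq e; rewrite (Prop_irrelevance (projT1_eq e) erefl).
Qed.

(** * Orbits of a quandle *)

Lemma left_mult_group_inv (Q : quandle) (g : Q -> Q) : left_mult_group g ->
  exists h, [/\ left_mult_group h, cancel g h & cancel h g].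
Proof.
elim=> [a||g1 g2 _ [h1 [H1 K1 L1]] _ [h2 [H2 K2 L2]]|g1 h1 G1 _ K L].
- have K : cancel (qop a) (qdiv a) by move=> x; rewrite qopK.
  have L : cancel (qdiv a) (qop a) by move=> x; rewrite qdivK.
  by exists (qdiv a); split=> //; apply: LMG_inv K L; apply: LMG_translation.
- by exists id; split=> //; apply: LMG_id.
- exists (h2 \o h1); split; [exact: LMG_comp | exact: can_comp | exact: can_comp].
- by exists g1.
Qed.

Lemma left_mult_group_div (Q : quandle) (a : Q) : left_mult_group (qdiv a).
Proof.
by apply: (LMG_inv (LMG_translation a)) => x; rewrite ?qopK ?qdivK.
Qed.

Lemma orbit_rel_refl (Q : quandle) (x : Q) : orbit_rel x x.
Proof. by exists id => //; apply: LMG_id. Qed.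

Lemma orbit_rel_sym (Q : quandle) (x y : Q) : orbit_rel x y -> orbit_rel y x.
Proof.
case=> g /left_mult_group_inv [h [H K _]] ->.
by exists h; rewrite ?K.
Qed.

Lemma orbit_rel_trans (Q : quandle) (x y z : Q) :
  orbit_rel x y -> orbit_rel y z -> orbit_rel x z.
Proof.
case=> g G -> [h H ->].
by exists (h \o g) => //; apply: LMG_comp.
Qed.

(** * Submodules as subgroups stable under an automorphism and its inverse *)

Section AutModuleClosed.
Variables (A : zmodType) (f : {additive A -> A}) (fbij : bijective f).

Lemma bij_invB : {morph bij_inv fbij : a b / a - b}.
Proof. by move=> a b; apply: (bij_inj fbij); rewrite raddfB !bij_invK. Qed.

Lemma bij_inv0 : bij_inv fbij 0 = 0.
Proof. by rewrite -{1}(subrr 0) bij_invB subrr. Qed.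

(** A Laurent polynomial acts as an integer combination of iterates of [f], followed by iterates of
    the inverse of [f]; each ingredient preserves [S]. *)
Lemma autmodule_submod_closed (S : {pred autmodule fbij}) :
    @zmod_closed A S ->
    (forall a : A, a \in S -> f a \in S) ->
    (forall a : A, a \in S -> bij_inv fbij a \in S) ->
  submod_closed S.
Proof.
move=> [S0 SB] Sf Sg.
have SN (a : A) : a \in S -> - a \in S by rewrite -sub0r; apply: SB.
have SD (a b : A) : a \in S -> b \in S -> a + b \in S.
  by move=> Sa Sb; rewrite -[b]opprK; apply: SB => //; apply: SN.
have Sz (a : A) (n : int) : a \in S -> a *~ n \in S.
  move=> Sa; have Sn m : a *+ m \in S.
    by elim: m => [|m IH]; rewrite ?mulr0n // mulrS SD.
  by case: n => n; [apply: Sn | rewrite NegzE mulrNz; apply: SN; apply: Sn].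
split=> // r a b Sa Sb; apply: (SD) => //.
have Siter (h : A -> A) n : (forall x : A, x \in S -> h x \in S) ->
    forall x : A, x \in S -> iter n h x \in S.
  by move=> Sh x Sx; elim: n => //= n; apply: Sh.
apply: (Siter) => //.
apply: (big_ind (fun x : A => x \in S)) => [|x y Sx Sy|i _] //.
  exact: SD.
by apply: Sz; apply: Siter.
Qed.

Lemma submod_closed_aut (S : {pred autmodule fbij}) (a : autmodule fbij) :
  submod_closed S -> a \in S -> f a \in S.
Proof.
move=> [S0 SZ] Sa; have := SZ (laurent_texp 1) a 0 Sa S0.
by rewrite addr0 scale_texp.
Qed.

Lemma submod_closed_aut_inv (S : {pred autmodule fbij}) (a : autmodule fbij) :
  submod_closed S -> a \in S -> bij_inv fbij a \in S.
Proof.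
(* [Negz 0] is -1, so the scalar is the inverse of [t]. *)
move=> [S0 SZ] Sa; have := SZ (laurent_texp (Negz 0)) a 0 Sa S0.
by rewrite addr0 scale_texp.
Qed.

End AutModuleClosed.

(** * Translations and orbits in the sum of a mesh *)

Section MeshSum.
Variables (I : Type) (M : affine_mesh I).
Local Notation A := (mesh_group M).
Local Notation phi := (mesh_phi M).
Local Notation c := (mesh_c M).
Local Notation Q := (mesh_sum M).
Local Notation elt i a := (existT A i a : Q).

Lemma mesh_translation i j (x : A i) (a : A j) :
  qop (elt i x) (qdiv (elt j 0) (elt j a)) = elt j (a + (c i j + phi i j x)).
Proof.
by rewrite /= raddf0 mesh_cii !subr0 bij_invK addrC.
Qed.

(** The sums [c i j + phi i j x] generate as much as the constants and images taken separately:
    [x = 0] gives [c i j], and subtracting it leaves [phi i j x]. *)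
Lemma indecomposable_ind (hM : indecomposable M) j (P : A j -> Prop) :
    P 0 -> (forall a b, P a -> P b -> P (a - b)) ->
    (forall i (x : A i), P (c i j + phi i j x)) ->
  forall a, P a.
Proof.
move=> P0 PB Pgen a; apply/asboolP.
have Pc i : P (c i j) by have := Pgen i 0; rewrite raddf0 addr0.
apply: (hM j (fun a => `[< P a >])).
  split=> [|x y /asboolP Px /asboolP Py]; apply/asboolP => //.
  exact: PB.
move=> x hx; apply/asboolP; case: hx => [[i ->] //|[i [y ->]]].
by have := PB _ _ (Pgen i y) (Pc i); rewrite addrC addKr.
Qed.

Lemma mesh_orbit_transitive (hM : indecomposable M) j (a b : A j) :
  orbit_rel (elt j a) (elt j b).
Proof.
(* The base point stays quantified because the case [h - k] uses the hypothesis on [k] at the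
   shifted point [d - k]. *)
have H : forall h, forall a, orbit_rel (elt j a) (elt j (a + h)).
  apply: (indecomposable_ind hM) => [d|h k Hh Hk d|i x d].
  - by rewrite addr0; apply: orbit_rel_refl.
  - apply: (@orbit_rel_trans _ _ (elt j (d - k))).
      by apply: orbit_rel_sym; have := Hk (d - k); rewrite subrK.
    by rewrite [h - k]addrC addrA.
  - rewrite -mesh_translation.
    exists (qop (elt i x) \o qdiv (elt j 0)) => //.
    by apply: LMG_comp; [apply: LMG_translation | apply: left_mult_group_div].
by have := H (b - a) a; rewrite addrC subrK.
Qed.

(** * From congruences to submodules *)

Section Congruence.
Variables (hM : indecomposable M) (rho : Q -> Q -> Prop).
Hypothesis rhoC : congruence rho.

Lemma congruence_translate j (h a b : A j) :
  rho (elt j a) (elt j b) -> rho (elt j (a + h)) (elt j (b + h)).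
Proof.
case: rhoC => refl _ _ hop hdiv.
(* With an equivalence in place of an implication, the admissible [h] are closed under subtraction,
   as the induction requires. *)
have inv : forall a b : A j,
    rho (elt j a) (elt j b) <-> rho (elt j (a + h)) (elt j (b + h)).
  move: h; apply: (indecomposable_ind hM) => [d e|k l Hk Hl d e|i x d e].
  - by rewrite !addr0.
  - have := Hl (d - l) (e - l); rewrite !subrK => <-.
    by rewrite Hk -!addrA ![- l + k]addrC.
  - split=> [r|].
      by rewrite -!mesh_translation; apply: hop => //; apply: hdiv.
    rewrite -!mesh_translation => r.
    (* The translation is undone by dividing by [x], then multiplying by the zero of [A j]. *)
    have {}r := hdiv _ _ _ _ (refl (elt i x)) r; rewrite !qopK in r.
    by have := hop _ _ _ _ (refl (elt j 0)) r; rewrite !qdivK.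
by move/inv.
Qed.

Lemma congruence_sub0 j (a b : A j) :
  rho (elt j a) (elt j b) <-> rho (elt j (a - b)) (elt j 0).
Proof.
split=> [/(congruence_translate (- b))|/(congruence_translate b)].
  by rewrite subrr.
by rewrite subrK add0r.
Qed.

Definition congruence_zero_class i : {pred mesh_module M i} :=
  fun a => `[< rho (elt i a) (elt i 0) >].

Lemma congruence_zero_classP i (a : A i) :
  reflect (rho (elt i a) (elt i 0)) (a \in @congruence_zero_class i).
Proof. exact: asboolP. Qed.

(** Since [c i i = 0], multiplication and division by the zero of [A i] act on [A i] as [t] and its
    inverse, and both fix zero. *)
Lemma congruence_zero_class_submod i : submod_closed (@congruence_zero_class i).
Proof.
case: rhoC => refl sym trans hop hdiv.
apply: autmodule_submod_closed => [|a|a].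
- split=> [|a b]; first exact/congruence_zero_classP.
  move=> /congruence_zero_classP ra /congruence_zero_classP rb.
  apply/congruence_zero_classP.
  by apply: (proj1 (congruence_sub0 a b)); apply: trans ra _; apply: sym.
- move=> /congruence_zero_classP /(hop _ _ _ _ (refl (elt i 0))) /=.
  rewrite !raddf0 mesh_cii !add0r => ra.
  exact/congruence_zero_classP.
- move=> /congruence_zero_classP /(hdiv _ _ _ _ (refl (elt i 0))) /=.
  rewrite !raddf0 mesh_cii !(subr0, addr0) bij_inv0 => ra.
  exact/congruence_zero_classP.
Qed.

(** Multiplying the zero of [A j] on the left by [a] and by the zero of [A k] gives
    [c k j + phi k j a] and [c k j], whose difference is [phi k j a]. *)
Lemma congruence_zero_class_phi k j (a : A k) :
  a \in @congruence_zero_class k -> phi k j a \in @congruence_zero_class j.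
Proof.
case: rhoC => refl _ _ hop _ /congruence_zero_classP.
move/hop/(_ (refl (elt j 0))) => /=.
rewrite !raddf0 !addr0 => /congruence_sub0; rewrite addrC addKr => r.
exact/congruence_zero_classP.
Qed.

End Congruence.

(** * From families of submodules to congruences *)

Section Family.
Variable N : forall i, {pred mesh_module M i}.
Arguments N : clear implicits.
Hypothesis Nsub : forall i, submod_closed (N i).
Hypothesis Nphi : forall k j (a : mesh_module M k),
  a \in N k -> phi k j a \in N j.

Lemma family_relP i (a b : A i) :
  family_rel N (elt i a) (elt i b) <-> (a - b : A i) \in N i.
Proof.
split=> [[j [a' [b' [ea eb Nab]]]]|Nab]; last by exists i, a, b.
have ij := projT1_eq ea; rewrite /= in ij; subst j.
by rewrite (existT_inj ea) (existT_inj eb).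
Qed.

Lemma family_rel_congruence : congruence (family_rel N).
Proof.
have N0 i : (0 : A i) \in N i by case: (Nsub i).
have ND i (a b : A i) : a \in N i -> b \in N i -> a + b \in N i.
  case: (Nsub i) => _ NZ Na Nb.
  by have := NZ 1 _ _ Na Nb; rewrite scale1r.
have NN i (a : A i) : a \in N i -> - a \in N i.
  case: (Nsub i) => _ NZ Na.
  by have := NZ (-1) _ _ Na (N0 i); rewrite scaleN1r addr0.
have NB i (a b : A i) : a \in N i -> b \in N i -> a - b \in N i.
  by move=> Na Nb; apply: ND => //; apply: NN.
split.
- by case=> i a; apply/family_relP; rewrite subrr.
- move=> _ _ [i [a [b [-> -> Nab]]]]; apply/family_relP.
  by have := NN _ _ Nab; rewrite opprB.
- move=> _ _ [k z] [i [a [b [-> -> Nab]]]] h.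
  (* The middle point lies in a single component, which forces all indices to agree. *)
  case: (h) => j [b' [c' [eb ec _]]].
  have ik := projT1_eq ec; have ij := projT1_eq eb; rewrite /= in ik ij.
  subst k; subst j; apply/family_relP; move/family_relP: h => Nbz.
  by have := ND _ _ _ Nab Nbz; rewrite addrA subrK.
- move=> _ _ _ _ [i [a [a' [-> -> Na]]]] [j [b [b' [-> -> Nb]]]].
  apply/family_relP.
  (* The constants cancel: the two products differ by [phi i j (a - a')] plus [t] times [b - b']. *)
  rewrite opprD addrACA -raddfB; apply: ND; last first.
    exact: (submod_closed_aut (fbij := one_sub_phi_bij M j) (Nsub j)).
  by rewrite opprD addrACA subrr add0r -raddfB; apply: Nphi.
- move=> _ _ _ _ [i [a [a' [-> -> Na]]]] [j [b [b' [-> -> Nb]]]].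
  apply/family_relP; rewrite -bij_invB; apply: submod_closed_aut_inv (Nsub j) _.
  (* This is the difference of the quotients before the inverse of [t] is applied. *)
  rewrite [X in X \in _](_ : _ = (b - b') - phi i j (a - a')).
    by apply: NB => //; apply: Nphi.
  rewrite (raddfB (phi i j)) !opprD !opprK !addrA [LHS](ACl (1*4*2*5*(3*6))) /=.
  by rewrite addNr addr0.
Qed.

End Family.

End MeshSum.

Theorem theorem3p2 (I : Type) (M : affine_mesh I) (hM : indecomposable M) :
  (forall rho : mesh_sum M -> mesh_sum M -> Prop,
     congruence rho -> subrel_prop rho (@orbit_rel (mesh_sum M)) ->
     exists N : forall i, {pred mesh_module M i},
       [/\ forall i, submod_closed (N i),
           forall i (a b : mesh_module M i),
             rho (mesh_elt a) (mesh_elt b) <-> a - b \in N i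
         & forall k j (a : mesh_module M k),
             a \in N k -> mesh_phi M k j a \in N j])
  /\
  (forall N : forall i, {pred mesh_module M i},
     (forall i, submod_closed (N i)) ->
     (forall k j (a : mesh_module M k),
        a \in N k -> mesh_phi M k j a \in N j) ->
     subrel_prop (family_rel N) (@orbit_rel (mesh_sum M)) /\
     congruence (family_rel N)).
Proof.
split=> [rho rhoC _|N Nsub Nphi].
  exists (@congruence_zero_class I M rho); split.
  - exact: congruence_zero_class_submod.
  - move=> i a b; apply: iff_trans (congruence_sub0 hM rhoC a b) _.
    by split=> [r|/congruence_zero_classP //]; apply/congruence_zero_classP.
  - by move=> k j a; apply: congruence_zero_class_phi.
split; last exact: family_rel_congruence.
by move=> _ _ [i [a [b [-> -> _]]]]; apply: mesh_orbit_transitive.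
Qed.
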